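(* Suppose that $\lambda$ is a regular uncountable cardinal. If $\lambda$ admits a stationary set that does not reflect at regulars, or if $\square(\lambda,{<}\mu)$ holds for some cardinal $\mu<\lambda$, then the following are equivalent: (1) $\mathrm{Pr}_1(\lambda^+,\lambda^+,\lambda^+,\lambda)$; (2) $\mathrm{Pr}_1(\lambda^+,\lambda^+,\lambda,\lambda)$; (3) $\mathrm{U}_1(\lambda^+,2,\lambda,\lambda)$.
   Context: Work in ZFC. For sets of ordinals $a,b$, write $a<b$ iff $\alpha<\beta$ for all $\alpha\in a$ and $\beta\in b$. For an ordinal $\sigma$, $[\kappa]^\sigma$ is the collection of all subsets of $\kappa$ of order type $\sigma$. As an exception, $[\kappa]^2:=\{(\alpha,\beta)\mid \alpha<\beta<\kappa\}$, and for a collection $\mathcal A$ of sets of ordinals, $[\mathcal A]^2:=\{(a,b)\in\mathcal A\times\mathcal A\mid a<b\}$. $\mathrm{Pr}_1(\kappa,\kappa,\theta,\chi)$ asserts the existence of a coloring $c:[\kappa]^2\rightarrow\theta$ such that for every $\sigma<\chi$, every pairwise disjoint subfamily $\mathcal A\subseteq[\kappa]^\sigma$ of size $\kappa$, and every $\tau<\theta$, there is $(a,b)\in[\mathcal A]^2$ such that $c[a\times b]=\{\tau\}$. $\mathrm{U}_1(\kappa,2,\theta,\chi)$ asserts the existence of a coloring $c:[\kappa]^2\rightarrow\theta$ such that for every $\sigma<\chi$, every pairwise disjoint subfamily $\mathcal A\subseteq[\kappa]^\sigma$ of size $\kappa$, and every $\epsilon<\theta$, there exist $(a,b)\in[\mathcal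 A]^2$ and $\tau<\theta$ with $\tau>\epsilon$ such that $c[a\times b]=\{\tau\}$. A stationary set $S\subseteq\lambda$ does not reflect at regulars iff there is no regular uncountable cardinal $\alpha<\lambda$ such that $S\cap\alpha$ is stationary in $\alpha$. For a set of ordinals $C$, $\mathrm{acc}(C):=\{\alpha\in C\mid \sup(C\cap\alpha)=\alpha>0\}$. For a regular uncountable cardinal $\kappa$ and a cardinal $\mu\le\kappa$, $\square(\kappa,{<}\mu)$ asserts the existence of a sequence $\langle\mathcal C_\alpha\mid\alpha<\kappa\rangle$ such that: (i) for every $\alpha<\kappa$, $\mathcal C_\alpha$ is a nonempty collection of less than $\mu$ many closed subsets $C$ of $\alpha$ with $\sup(C)=\sup(\alpha)$; (ii) for all $\alpha<\kappa$, $C\in\mathcal C_\alpha$ and $\delta\in\mathrm{acc}(C)$, $C\cap\delta\in\mathcal C_\delta$; (iii) there exists no club $C$ in $\kappa$ such that $C\cap\alpha\in\mathcal C_\alpha$ for all $\alpha\in\mathrm{acc}(C)$. *)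

(* Defs.v *)
From mathcomp Require Import all_boot all_order.
From mathcomp Require Import boolp classical_sets functions cardinality wochoice.

Set Implicit Arguments.
Unset Strict Implicit.
Unset Printing Implicit Defensive.

Local Open Scope order_scope.
Local Open Scope card_scope.
Local Open Scope classical_set_scope.

(* An ordinal is represented by a well-ordered type T (an [orderType] with
   [well_order <=%O]).  The ordinals below it are represented by the elements
   of T, the von Neumann ordinal a being the initial segment [below a].
   Notions that apply both to T and to the ordinals below it are stated for
   an initial segment D of T, namely [set: T] or [below a]. *)

Definition below d (T : orderType d) (a : T) : set T := [set x | x < a].

Section Ordinals.
Context d (T : orderType d).
Implicit Types (A C D S : set T) (a b : T).

(* [~ (A #<= B)] is |B| < |A|, by comparability of cardinals. *)
Definition is_cardinal D := forall a, D a -> ~ (D #<= below a).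

Definition cofinal_in D C :=
  C `<=` D /\ forall x, D x -> exists2 y, C y & x <= y.

Definition regular_uncountable D :=
  [/\ is_cardinal D,
      ~ countable D
    & forall C, cofinal_in D C -> D #<= C].

(* The a > 0 such that sup (C `&` a) = a. *)
Definition limit_points C : set T :=
  [set a | below a !=set0 /\ isLub (C `&` below a) a].

Definition acc C : set T := C `&` limit_points C.

Definition closed_in D C := C `<=` D /\ D `&` limit_points C `<=` C.

Definition club_in D C := closed_in D C /\ cofinal_in D C.

Definition stationary_in D S :=
  S `<=` D /\ forall C, club_in D C -> S `&` C !=set0.

Definition reflects_at_regular S :=
  exists a, regular_uncountable (below a)
            /\ stationary_in (below a) (S `&` below a).

(* For T a regular uncountable cardinal kappa and m a cardinal mu < kappa:
   the principle square(kappa, <mu).  Suprema of proper initial segments are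
   taken in T, so that [below a] has supremum b if a is the successor of b,
   and a otherwise. *)
Definition square_lt (m : T) :=
  exists CC : T -> set (set T),
  [/\ forall a,
        [/\ CC a !=set0,
            ~ (below m #<= CC a)
          & forall C, CC a C ->
              closed_in (below a) C
              /\ exists2 s, isLub C s & isLub (below a) s],
      forall a C, CC a C -> forall b, acc C b -> CC b (C `&` below b)
    & ~ exists C, club_in [set: T] C
                  /\ forall a, acc C a -> CC a (C `&` below a)].

End Ordinals.

(* K is the least ordinal that does not inject into L. *)
Definition is_successor_cardinal dL (L : orderType dL) dK (K : orderType dK) :=
  ~ ([set: K] #<= [set: L]) /\ forall a : K, below a #<= [set: L].

Section Colorings.
Context dK (K : orderType dK) dX (X : orderType dX).
Implicit Types (a b : set K) (A : set (set K)) (s : X).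

(* The order type of a is s; [f] is only constrained on a. *)
Definition has_order_type a s :=
  exists f : K -> X,
    set_bij a (below s) f
    /\ forall x y, a x -> a y -> x < y -> f x < f y.

Definition set_lt a b := forall x y, a x -> b y -> x < y.

(* Pairwise disjoint subfamilies of [K]^s of size |K|. *)
Definition large_disjoint_family s A :=
  [/\ forall a, A a -> has_order_type a s,
      trivIset A id
    & A #= [set: K]].

(* Pr_1(kappa, kappa, theta, chi) for K = kappa, Theta = theta, X = chi.  Here
   and in [U1], a coloring of the increasing pairs is represented by a binary
   function, whose values at the other pairs are never used. *)
Definition Pr1 (Theta : Type) :=
  exists c : K -> K -> Theta,
  forall s A, large_disjoint_family s A ->
  forall t : Theta,
  exists a b, [/\ A a, A b, set_lt a b
                & [set c x y | x in a & y in b] = [set t]].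

(* U_1(kappa, 2, theta, chi) for K = kappa, Theta = theta, X = chi. *)
Definition U1 dT (Theta : orderType dT) :=
  exists c : K -> K -> Theta,
  forall s A, large_disjoint_family s A ->
  forall e : Theta,
  exists a b t, [/\ A a, A b, set_lt a b, e < t
                  & [set c x y | x in a & y in b] = [set t]].

End Colorings.

Arguments Pr1 {dK} K {dX} X Theta.
Arguments U1 {dK} K {dX} X {dT} Theta.
Arguments square_lt {d} T m.

(* Main.v *)
(* For a coloring c witnessing U_1 and a large family A, let T(A) be the set of
   constant values of c on rectangles a x b with a < b in A.  Taking unions of
   members of fewer than lambda families shows that the sets T(A), up to bounded
   subsets of lambda, generate a proper lambda-complete filter on lambda.  A map
   h : lambda -> lambda with positive fibres makes h o c a witness to Pr_1 with
   lambda colors.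

   Such an h exists for every lambda-complete filter extending the tails.
   Otherwise disjoint families of positive sets have size < lambda, so there is a
   least function unbounded modulo the filter, and pushing forward along it
   makes every regressive function essentially bounded.  Almost every x < lambda
   is then a regular uncountable cardinal, and if C_x is cofinal in x for almost
   all x, there is a club D such that every a in D is a limit point of almost every
   C_x.  If S did not reflect at regulars, C_x could be chosen closed and disjoint
   from S, contradicting that S meets D.  For C_x in the x-th member of a square
   sequence of width < mu, almost all levels are separated below one fixed s, and
   the sets C_x with a fixed trace below some a_0 > s in D converge to a thread.

   To get lambda^+ colors, take eventually different functions p_t : lambda ->
   lambda (t < lambda^+) with h (p_t i) = i.  Given y, enumerated in type lambda,
   and a color p_t i with t < y and i large, t is the first z in this enumeration
   with p_z i = p_t i. *)

Require Import Defs.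
From mathcomp Require Import all_boot all_order.
From mathcomp Require Import boolp classical_sets functions cardinality wochoice.

Set Implicit Arguments.
Unset Strict Implicit.
Unset Printing Implicit Defensive.

Import Order.TTheory.

Local Open Scope order_scope.
Local Open Scope card_scope.
Local Open Scope classical_set_scope.

(** * Cardinal comparison through injections and surjections *)

Section Cardinality.
Context {I J : Type}.
Implicit Types (A : set I) (B : set J).

Lemma inj_card_leP A B (f : I -> J) :
    (forall x, A x -> B (f x)) ->
    (forall x y, A x -> A y -> f x = f y -> x = y) ->
  A #<= B.
Proof.
move=> fAB finj; apply: (@card_le_trans _ _ _ (f @` A)).
  have finj' : {in A &, injective f}.
    by move=> x y /set_mem Ax /set_mem Ay; exact: finj.
  by have /card_eqPle[] := inj_card_eq finj'.
by apply: subset_card_le => _ [x Ax <-]; exact: fAB.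
Qed.

Lemma card_le_surj A B : A !=set0 -> A #<= B ->
  exists g : J -> I, (forall y, A (g y)) /\ (forall x, A x -> exists2 y, B y & g y = x).
Proof.
move=> [a Aa] /pfcard_geP[A0|]; first by move: Aa; rewrite A0.
case/surjfunPex => f Af.
exists (fun y => if pselect (B y) then f y else a); split=> [y|x].
  by case: pselect => // By; rewrite Af; exists y.
by rewrite {1}Af => -[y By <-]; exists y => //; case: pselect.
Qed.

Lemma card_le_inj A B : A !=set0 -> A #<= B ->
  exists f : I -> J, (forall x, A x -> B (f x)) /\
    (forall x y, A x -> A y -> f x = f y -> x = y).
Proof.
move=> A0 AB; have [g [gA gs]] := card_le_surj A0 AB.
have [a Aa] := A0; have [b0 _ _] := gs a Aa.
have ex x : exists y, A x -> B y /\ g y = x.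
  by have [/gs[y By gy]|nA] := pselect (A x); [exists y | exists b0].
have [f fP] := choice ex.
exists f; split=> [x /fP[]//|x y /fP[_ fx] /fP[_ fy] fxy].
by rewrite -fx -fy fxy.
Qed.

End Cardinality.

(** * Minima, recursion and descent in a well-order *)

Section WellOrder.
Context {d} {T : orderType d}.
Hypothesis wo : well_order (<=%O : rel T).

Lemma wo_min (A : set T) : A !=set0 -> exists2 x, A x & forall y, A y -> x <= y.
Proof.
move=> [a Aa].
have [|x [[+ xmin] _]] := wo (A := [pred x | `[< A x >]]).
  by exists a; rewrite inE.
by rewrite inE => Ax; exists x => // y Ay; apply: xmin; rewrite inE.
Qed.

Lemma wo_wf : well_founded (fun x y : T => x < y).
Proof.
move=> x; apply: contrapT => nx.
have [y ny ymin] := wo_min (A := [set y | ~ Acc (fun x y : T => x < y) y]) (ex_intro _ x nx).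
apply: ny; constructor => z zy; apply: contrapT => /ymin.
by rewrite leNgt zy.
Qed.

(* [P x f y]: the value [y] is admissible at [x] when [f] is already defined
   below [x]. *)
Lemma wo_rec (X : Type) (x0 : X) (P : T -> (T -> X) -> X -> Prop) :
    (forall x f g y, (forall z, z < x -> f z = g z) -> P x f y -> P x g y) ->
    (forall x f, (forall z, z < x -> P z f (f z)) -> exists y, P x f y) ->
  exists f, forall x, P x f (f x).
Proof.
move=> Pext Pex.
(* Recursive values exist only below [x]; [ext] pads them with [x0], and [Pext] makes the padding
   irrelevant. *)
pose ext (x : T) (r : forall z, z < x -> X) (z : T) :=
  if pselect (z < x) is left zx then r z zx else x0.
pose F (x : T) (r : forall z, z < x -> X) :=
  if pselect (exists y, P x (ext x r) y) is left h then projT1 (cid h) else x0.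
pose f := Fix wo_wf (fun _ => X) F.
have extE x (z : T) : z < x -> ext x (fun z _ => f z) z = f z.
  by rewrite /ext; case: pselect.
have fE x : f x = F x (fun z _ => f z).
  rewrite /f Fix_eq // => y g h gh; congr F.
  by apply: functional_extensionality_dep => z; apply: functional_extensionality_dep => p.
exists f; apply: (well_founded_ind wo_wf) => x IH.
have [y Py] := Pex x f IH.
rewrite fE /F; case: pselect => [h|[]].
  by case: (cid h) => /= z; apply: Pext => w wx; rewrite extE.
by exists y; apply: Pext Py => z zx; rewrite extE.
Qed.

Lemma wo_no_descent (u : nat -> T) : ~ (forall n, u n.+1 < u n).
Proof.
move=> dec; have [|_ [n _ <-] nmin] := wo_min (A := range u); first by exists (u 0); exists 0.
by have := nmin (u n.+1) (ex_intro2 _ _ n.+1 I erefl); rewrite leNgt dec.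
Qed.

End WellOrder.

(* By transitive collapse of a into D. *)
Lemma order_type_exists dK (K : orderType dK) dX (X : orderType dX)
    (K_wo : well_order (<=%O : rel K)) (X_wo : well_order (<=%O : rel X))
    (D : set X) (a : set K) :
    (forall x y, D y -> x <= y -> D x) -> ~ (D #<= a) ->
  exists2 s, D s & has_order_type a s.
Proof.
move=> Ddown Da.
have Dne : D !=set0.
  by apply/set0P; apply: contra_notN Da => /eqP ->; exact: card_ge0.
have [x0 Dx0] := Dne.
pose im (x : K) (f : K -> X) : set X := f @` (a `&` below x).
pose P (x : K) (f : K -> X) (y : X) :=
  [/\ D y, ~ im x f y & forall z, D z -> ~ im x f z -> y <= z].
have [x f g y fg|x f IH|f fP] := @wo_rec _ _ K_wo X x0 P.
- rewrite /P (_ : im x f = im x g)//.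
  by apply/seteqP; split=> _ [z [az zx] <-]; exists z => //; rewrite fg.
(* A free value remains, as the values already used number at most |a|. *)
- have [z Dz nz] : exists2 z, D z & ~ im x f z.
    apply: contrapT => nex; apply: Da.
    apply: (@card_le_trans _ _ _ (im x f)).
      by apply: subset_card_le => z Dz; apply: contrapT => nz; apply: nex; exists z.
    by rewrite (card_le_trans (card_image_le _ _))// subset_card_le// => ? [].
  have [y [Dy ny] ymin] := wo_min X_wo (A := [set z | D z /\ ~ im x f z]) (ex_intro _ z (conj Dz nz)).
  by exists y; split=> // w Dw nw; exact: ymin.
have fmono x y : a x -> a y -> x < y -> f x < f y.
  move=> ax ay xy; have [_ ny _] := fP y; have [_ _ xmin] := fP x.
  have [Dy _ _] := fP y.
  rewrite lt_neqAle; apply/andP; split; first by apply/eqP => fxy; apply: ny; exists x.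
  apply: xmin => // -[z [az zx] fz]; apply: ny; exists z => //; split=> //.
  exact: lt_trans xy.
have [s [Ds ns] smin] : exists2 s, (D `\` f @` a) s & forall z, (D `\` f @` a) z -> s <= z.
  apply: (wo_min X_wo); apply: contrapT => nex; apply: Da.
  rewrite (card_le_trans _ (card_image_le f a))// subset_card_le// => z Dz.
  by apply: contrapT => nz; apply: nex; exists z.
exists s => //; exists f; split=> //; split.
- move=> x ax; rewrite /below /= ltNge; apply/negP => sfx.
  have [_ _ xmin] := fP x.
  move: sfx; rewrite le_eqVlt => /orP[/eqP sfx|sfx]; first by apply: ns; exists x.
  have : ~ im x f s by move=> [z [az _] fz]; apply: ns; exists z.
  by move=> /(xmin s Ds); rewrite leNgt sfx.
- move=> x y /set_mem ax /set_mem ay fxy.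
  by case: (ltgtP x y) => [/(fmono _ _ ax ay)|/(fmono _ _ ay ax)|//]; rewrite fxy ltxx.
move=> y ys; apply: contrapT => ny.
have : s <= y by apply: smin; split=> //; apply: Ddown Ds (ltW ys).
by rewrite leNgt ys.
Qed.

(** * Bounds from regularity *)

Section Regular.
Context {d} {T : orderType d}.
Implicit Types (D : set T) (x y : T).

(** Otherwise the image of [F] would be cofinal in [D], hence of size at least |D|. *)
Lemma regular_bounded D I (F : set I) (f : I -> T) : regular_uncountable D ->
    ~ (D #<= F) -> (forall i, F i -> D (f i)) ->
  exists2 s, D s & forall i, F i -> f i < s.
Proof.
move=> [_ _ reg] DF fD.
have [s Ds sP] : exists2 s, D s & ~ exists2 y, (f @` F) y & s <= y.
  apply: contrapT => nex; apply: DF; apply: card_le_trans (card_image_le f F).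
  apply: reg; split=> [_ [i Fi <-]|x Dx]; first exact: fD.
  by apply: contrapT => nx; apply: nex; exists x.
exists s => // i Fi; rewrite ltNge; apply/negP => sfi.
by apply: sP; exists (f i) => //; exists i.
Qed.

Lemma regular_no_max D x : regular_uncountable D -> D x -> exists2 y, D y & x < y.
Proof.
move=> regD Dx; have [_ uncD _] := regD.
have [||y Dy /(_ _ erefl)] := @regular_bounded D T [set x] id regD; last by exists y.
  by move=> Dx1; apply: uncD; apply: sub_countable (countable1 x).
by move=> _ ->.
Qed.

End Regular.

Definition small d (L : orderType d) (I : Type) (F : set I) := ~ ([set: L] #<= F).

(** * Sets of size less than lambda *)

Section Small.
Context {d} {lam : orderType d}.
Hypothesis wo : well_order (<=%O : rel lam).
Hypothesis reg : regular_uncountable [set: lam].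
Local Notation small := (small lam).

Lemma small_le I J (F : set I) (G : set J) : F #<= G -> small G -> small F.
Proof. by move=> FG sG lF; apply: sG; exact: card_le_trans FG. Qed.

Lemma small_countable I (F : set I) : countable F -> small F.
Proof. by have [_ unc _] := reg => cF lF; apply: unc; exact: sub_countable cF. Qed.

Lemma small_below (j : lam) : small (below j).
Proof. by have [card _ _] := reg; exact: card. Qed.

Lemma small_bounded I (F : set I) (f : I -> lam) : small F ->
  exists s, forall i, F i -> f i < s.
Proof. by move=> sF; have [//|s _] := @regular_bounded _ lam [set: lam] I F f reg sF; exists s. Qed.

Lemma lt_exists (x : lam) : exists y, x < y.
Proof. by have [y _] := @regular_no_max _ lam [set: lam] x reg I; exists y. Qed.

Lemma least_exists : exists bot : lam, forall x, bot <= x.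
Proof.
have [_ unc _] := reg.
have [|b _ bP] := wo_min wo (A := [set: lam]); last by exists b => x; exact: bP.
by apply/set0P; apply: contra_notN unc => /eqP ->; exact: countable0.
Qed.

(** Given an injection of lambda into the union, the indices sent into each [B i] are bounded, and
    regularity bounds these bounds by some [s]; the index [s] itself is then sent nowhere. *)
Lemma small_bigcup I J (F : set I) (B : I -> set J) : small F ->
  (forall i, F i -> small (B i)) -> small (\bigcup_(i in F) B i).
Proof.
move=> sF sB le; have [b bP] := least_exists.
have [g [gB ginj]] := card_le_inj (ex_intro _ b Logic.I : [set: lam] !=set0) le.
have bnd i : exists j, F i -> forall x, B i (g x) -> x < j.
  have [Fi|nFi] := pselect (F i); last by exists b.
  have [|j jP] := @small_bounded lam [set x | B i (g x)] id; last by exists j.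
  apply: small_le (sB i Fi); apply: (@inj_card_leP _ _ _ _ g) => // x y _ _.
  exact: ginj.
have [j jP] := choice bnd.
have [s sP] := small_bounded j sF.
have [i Fi Bis] := gB s Logic.I.
by have := lt_trans (sP i Fi) (jP i Fi s Bis); rewrite ltxx.
Qed.

(* The duals of the lam-complete proper ideals on lam containing the bounded sets. *)
Record complete_filter (F : set (set lam)) : Prop := CompleteFilter {
  filter_sub : forall A B, A `<=` B -> F A -> F B;
  filter_bigcap : forall G : set (set lam), small G -> G `<=` F ->
    F [set x | forall A, G A -> A x];
  filter_gt : forall j, F [set x | j < x];
  filter_neq0 : ~ F set0 }.

Definition positive (F : set (set lam)) (A : set lam) := ~ F (~` A).

Definition weakly_normal (F : set (set lam)) :=
  forall g : lam -> lam, F [set x | g x < x] -> exists j, F [set x | g x < j].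

(** * Complete filters and positive sets *)

Section Filter.
Variable F : set (set lam).
Hypothesis cF : complete_filter F.

Lemma filter_all I (G : set I) (P : I -> set lam) : small G ->
  (forall i, G i -> F (P i)) -> F [set x | forall i, G i -> P i x].
Proof.
move=> sG FP; have := filter_bigcap cF (G := P @` G).
move=> /(_ (small_le (card_image_le _ _) sG)) FG.
apply: filter_sub (FG _) => // [x Gx i Gi|_ [i Gi <-]]; last exact: FP.
by apply: Gx; exists i.
Qed.

Lemma filter_and (A B : set lam) : F A -> F B -> F [set x | A x /\ B x].
Proof.
move=> FA FB; have := @filter_all bool [set: bool] (fun b => if b then A else B).
move=> /(_ (small_countable (countableP _))) FG.
apply: filter_sub (FG _) => // [x Gx|[]//].
by split; [exact: (Gx true)|exact: (Gx false)].
Qed.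

Lemma filter_ex (A : set lam) : F A -> exists x, A x.
Proof.
move=> FA; apply: contrapT => nA; apply: (filter_neq0 cF).
by apply: filter_sub FA => // x Ax; apply: nA; exists x.
Qed.

Lemma filterT (A : set lam) : (forall x, A x) -> F A.
Proof. by move=> AT; have [b _] := least_exists; apply: filter_sub (filter_gt cF b). Qed.

Lemma positive_ex (A B : set lam) : positive F A -> F B -> exists x, A x /\ B x.
Proof.
move=> pA FB; apply: contrapT => nAB; apply: pA.
by apply: filter_sub FB => // x Bx Ax; apply: nAB; exists x.
Qed.

(** Otherwise some [h] is constant, with distinct values exhausting lambda, on lambda many of the
    sets [B i], so all its fibres are positive. *)
Lemma disjoint_positive_small I (D : set I) (B : I -> set lam) :
    ~ (exists h : lam -> lam, forall t, positive F (h @^-1` [set t])) ->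
    trivIset D B -> (forall i, D i -> positive F (B i)) -> small D.
Proof.
move=> sat tB pB le; apply: sat; have [b _] := least_exists.
have [e [eD einj]] := card_le_inj (ex_intro _ b Logic.I : [set: lam] !=set0) le.
have [h hP] : {h : lam -> lam & forall x t, B (e t) x -> h x = t}.
  apply: (@choice _ _ (fun x s => forall t, B (e t) x -> s = t)) => x.
  have [[t Bt]|nt] := pselect (exists t, B (e t) x); last by exists b => t Bt; case: nt; exists t.
  exists t => s Bs; apply: einj => //; apply: tB; [exact: eD..|].
  by exists x.
exists h => t nt; apply: (pB (e t) (eD t Logic.I)).
by apply: filter_sub nt => // x nx Bx; apply: nx; exact: hP.
Qed.

End Filter.

(** * Least unbounded functions and weak normality *)

Definition unbounded_on (F : set (set lam)) (X : set lam) (f : lam -> lam) :=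
  forall j, F [set x | X x -> j <= f x].

(** If there were none, every unbounded function would have another one strictly below it almost
    everywhere. Iterating from the identity, countable completeness gives a point at which the
    values descend forever. *)
Lemma least_unbounded_function F : complete_filter F ->
    ~ (exists h : lam -> lam, forall t, positive F (h @^-1` [set t])) ->
  exists X f, [/\ positive F X, unbounded_on F X f &
    forall g, F [set x | X x -> g x < f x] -> exists j, F [set x | X x -> g x < j]].
Proof.
move=> cF sat; apply: contrapT => nogood.
have step X f : positive F X -> unbounded_on F X f ->
    exists Y g, [/\ Y `<=` X, positive F Y, forall x, Y x -> g x < f x & unbounded_on F Y g].
  move=> pX uf.
  have [g [gf gu]] : exists g, F [set x | X x -> g x < f x] /\
      forall j, ~ F [set x | X x -> g x < j].
    apply: contrapT => nog; apply: nogood; exists X, f; split=> // g gf.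
    by apply: contrapT => nj; apply: nog; exists g; split=> // j gj; apply: nj; exists j.
  (* The values of [g] with positive fibre are bounded by some [j]. Where [g] is at least [j], each
     value is taken on a null set only, so [g] exceeds every constant there. *)
  pose V := [set v | positive F (X `&` g @^-1` [set v])].
  have sV : small V.
    apply: (disjoint_positive_small cF (B := fun v => X `&` g @^-1` [set v])) => //.
    by move=> u v _ _ [x [[_ /= <-] [_ /= <-]]].
  have [j jP] := small_bounded id sV.
  exists [set x | [/\ X x, j <= g x & g x < f x]], g; split.
  - by move=> x [].
  - move=> nY; apply: (gu j); apply: filter_sub (filter_and cF nY gf) => //.
    move=> x [nx gfx] Xx; rewrite ltNge; apply/negP => jg.
    by apply: nx; split=> //; exact: gfx.
  - by move=> x [].
  - move=> k.
    have := filter_all cF (P := fun v => [set x | X x -> j <= g x -> g x = v -> False]) (small_below (j := k)).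
    move=> FP; apply: filter_sub (FP _) => // [x kx [Xx jx _] /=|v vk].
      by rewrite leNgt; apply/negP => gk; exact: (kx _ gk).
    have [vj|jv] := ltP v j.
      by apply: filterT => // x _ /[swap] ->; rewrite leNgt vj.
    have nV : ~ V v by move=> /jP /=; rewrite ltNge jv.
    by apply: filter_sub (contrapT nV) => // x nx Xx _ gx; apply: nx.
have glue f : exists g, unbounded_on F [set: lam] f ->
    unbounded_on F [set: lam] g /\ F [set x | g x < f x].
  have [uf|nuf] := pselect (unbounded_on F [set: lam] f); last by exists f.
  pose D := [set p : set lam * (lam -> lam) | [/\ positive F p.1,
     (forall x, p.1 x -> p.2 x < f x) & unbounded_on F p.1 p.2]].
  (* [step] gives smaller functions on positive pieces only; a maximal disjoint family of pieces is
     small and covers almost everything, so its functions can be glued. *)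
  have [E [ED tE maxE]] := ex_maximal_disjoint_subcollection fst D.
  have sE : small E.
    by apply: (disjoint_positive_small cF sat tE) => p /ED[].
  pose W := \bigcup_(p in E) p.1.
  have FW : F W.
    rewrite -[W]setCK; apply: contrapT => pW.
    have [|Y [g [YW pY gf ug]]] := step (~` W) f pW.
      by move=> j; apply: filter_sub (uf j) => // x jx _; exact: jx.
    have [y [Yy _]] := positive_ex cF pY (filterT cF (A := setT) (fun=> I)).
    apply: (maxE ((Y, g) |` E)).
    - split=> [p Ep|/(_ (Y, g))]; first by right.
      by move=> /(_ (or_introl erefl)) EY; apply: (YW y Yy); exists (Y, g).
    - by move=> p [->|/ED].
    have YE p : E p -> Y `&` p.1 !=set0 -> False.
      by move=> Ep [x [/YW nWx px]]; apply: nWx; exists p.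
    move=> p q [->|Ep] [->|Eq] //=; first by move=> /(YE _ Eq).
      by rewrite setIC => /(YE _ Ep).
    exact: tE.
  have [g gP] : {g : lam -> lam & forall x, W x -> exists p, [/\ E p, p.1 x & g x = p.2 x]}.
    apply: (@choice _ _ (fun x y => W x -> exists p, [/\ E p, p.1 x & y = p.2 x])) => x.
    have [[p Ep px]|nW] := pselect (W x); last by exists x.
    by exists (p.2 x) => _; exists p.
  exists g => _; split.
    move=> k.
    have := filter_all cF (P := fun p => [set x | p.1 x -> k <= p.2 x]) sE.
    move=> /(_ (fun p Ep => let: And3 _ _ u := ED p Ep in u k)) Fk.
    apply: filter_sub (filter_and cF FW Fk) => // x [/gP[p [Ep px gx]] kx] _.
    by rewrite gx; exact: kx.
  apply: filter_sub FW => // x /gP[p [Ep px gx]].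
  by have [_ pf _] := ED p Ep; rewrite /= gx; exact: pf.
have [next nextP] := choice glue.
pose u n := iter n next id.
have uP n : unbounded_on F [set: lam] (u n).
  elim: n => [|n IH]; last by have [] := nextP _ IH.
  by move=> j; apply: filter_sub (filter_gt cF j) => // x jx _; exact: ltW.
have [|x xP] := filter_ex cF (filter_all cF
  (P := fun n => [set x | u n.+1 x < u n x]) (G := [set: nat]) (small_countable (countableP _)) _).
  by move=> n _; have [] := nextP _ (uP n).
by apply: (wo_no_descent wo (u := fun n => u n x)) => n; exact: xP.
Qed.

(** Restrict [F] to [X] and push it forward along the least unbounded [f]: tails belong to the image
    since [f] is unbounded, and a regressive [g] becomes [g] after [f], which is below [f] and so
    bounded. *)
Lemma weakly_normal_exists F : complete_filter F ->
    ~ (exists h : lam -> lam, forall t, positive F (h @^-1` [set t])) ->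
  exists2 G, complete_filter G & weakly_normal G.
Proof.
move=> cF sat; have [X [f [pX uf fP]]] := least_unbounded_function cF sat.
exists [set Z | F [set x | X x -> Z (f x)]]; last by move=> g /fP.
split=> [A B AB|G sG GF|j|F0] /=.
- by apply: (filter_sub cF) => // x Ax Xx; apply: AB; exact: Ax.
- by apply: (filter_sub cF) (filter_all cF sG GF) => // x Gx Xx A GA; exact: Gx.
- have [k jk] := lt_exists j.
  by apply: (filter_sub cF) (uf k) => // x kx Xx; exact: lt_le_trans (kx Xx).
- by apply: pX; apply: (filter_sub cF) F0.
Qed.

(** * Regularity, common limit points and reflection under a weakly normal filter *)

Section WeaklyNormal.
Variable F : set (set lam).
Hypotheses (cF : complete_filter F) (nF : weakly_normal F).

Lemma regressive_bounded (X : set lam) (g : lam -> lam) : F [set x | X x -> g x < x] ->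
  exists j, F [set x | X x -> g x < j].
Proof.
move=> gX; have [b bP] := least_exists.
have [|j jP] := nF (g := fun x => if pselect (X x) then g x else b).
  apply: (filter_sub cF) (filter_and cF gX (filter_gt cF b)) => x /= [gx bx].
  by case: pselect => // /gx.
exists j; apply: (filter_sub cF) jP => x /=.
by case: pselect.
Qed.

Lemma regressive_family_bounded (X : set lam) I (E : set I) (g : lam -> I -> lam) : small E ->
    F [set x | X x -> forall i, E i -> g x i < x] ->
  exists j, F [set x | X x -> forall i, E i -> g x i < j].
Proof.
move=> sE gX; have [b _] := least_exists.
have ex i : exists j, E i -> F [set x | X x -> g x i < j].
  have [Ei|nEi] := pselect (E i); last by exists b.
  have [|j jP] := @regressive_bounded X (g ^~ i); last by exists j.
  by apply: (filter_sub cF) gX => x gx Xx; exact: gx.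
have [j jP] := choice ex.
have [s sP] := small_bounded j sE; exists s.
apply: (filter_sub cF) (filter_all cF sE jP) => x /= jx Xx i Ei.
exact: lt_trans (jx i Ei Xx) (sP i Ei).
Qed.

(** Enumerations of the countable [x] form countably many regressive functions. Their common bound
    [j] is below almost every [x], so it would itself be enumerated. *)
Lemma uncountable_filter : F [set x | ~ countable (below x)].
Proof.
have [b bP] := least_exists.
have ex x : exists g : nat -> lam, countable (below x) /\ b < x ->
    (forall n, g n < x) /\ (forall y, y < x -> exists n, g n = y).
  have [[cx bx]|nx] := pselect (countable (below x) /\ b < x); last by exists (fun=> b).
  have [|g [gx gs]] := @card_le_surj _ _ (below x) [set: nat] _ cx; first by exists b.
  by exists g => _; split=> // y /gs[n _ gn]; exists n.
have [g gP] := choice ex.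
have [||j jP] := @regressive_family_bounded [set x | countable (below x) /\ b < x]
    nat [set: nat] g.
- exact: small_countable (countableP _).
- by apply: (filterT cF) => x /= /gP[gx _] n _.
apply: (filter_sub cF) (filter_and cF jP (filter_and cF (filter_gt cF b) (filter_gt cF j))).
move=> x /= [gj [bx jx]] cx.
have [_ /(_ j jx)[n gn]] := gP x (conj cx bx).
by have := gj (conj cx bx) n Logic.I; rewrite gn ltxx.
Qed.

Definition singular_at (x c : lam) (C : set lam) :=
  [/\ c < x, cofinal_in (below x) C & C #<= below c].

(** Weak normality first bounds the sizes of the short cofinal sets by one [c], then their fewer
    than lambda elements by one [j]; such sets are not cofinal in an [x] above [j]. *)
Lemma not_singular_filter : F [set x | ~ exists c C, singular_at x c C].
Proof.
have [b bP] := least_exists.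
pose X := [set x | b < x /\ exists c C, singular_at x c C].
have ex x : exists p : lam * (lam -> lam), X x ->
    [/\ p.1 < x, forall y, p.2 y < x
      & forall y, y < x -> exists2 z, z < p.1 & y <= p.2 z].
  have [[bx [c [C [cx [Cx xC] Cc]]]]|nX] := pselect (X x); last by exists (b, id).
  have [y0 Cy0 _] := xC b bx.
  have [|g [gC gs]] := @card_le_surj _ _ C (below c) _ Cc; first by exists y0.
  exists (c, g) => _; split=> //= [y|y yx]; first exact/Cx/gC.
  by have [z /gs[w wc <-] yz] := xC y yx; exists w.
have [p pP] := choice ex.
have [|c cP] := @regressive_bounded X (fun x => (p x).1).
  by apply: (filterT cF) => x /pP[].
have [||j jP] := @regressive_family_bounded X lam (below c) (fun x => (p x).2).
- exact: small_below.
- by apply: (filterT cF) => x /= /pP[_ px _] n _; exact: px.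
apply: (filter_sub cF) (filter_and cF (filter_and cF cP jP)
  (filter_and cF (filter_gt cF b) (filter_gt cF j))).
move=> x /= [[pc pj] [bx jx]] sx.
have Xx : X x by [].
have [_ _ /(_ j jx)[z zp]] := pP x Xx.
by rewrite leNgt pj// /below /=; exact: lt_trans zp (pc Xx).
Qed.

(** If [x] is not a cardinal, all of [below x] is a cofinal set of smaller size; if it is a cardinal
    but not regular, a short cofinal set has order type some [c < x]. Both make [x] singular. *)
Lemma regular_filter : F [set x | regular_uncountable (below x)].
Proof.
apply: (filter_sub cF) (filter_and cF uncountable_filter not_singular_filter) => x /= [ux nx].
split=> // [a ax xa|C xC].
  apply: nx; exists a, (below x); split=> //; split=> // y yx.
  by exists y.
apply: contrapT => Cx; apply: nx.
have [||c cx [f [fbij _]]] := @order_type_exists _ _ _ _ wo wo (below x) C.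
- by move=> y z zx yz; exact: le_lt_trans yz zx.
- exact: Cx.
exists c, C; split=> //.
have [ff finj _] := fbij.
apply: (@inj_card_leP _ _ _ _ f) => // y z Cy Cz.
by apply: finj; rewrite inE.
Qed.

(** Weak normality gives [j e] such that almost every [C x] has a point strictly between [e] and
    [j e]. [D] consists of the closure points of [j], and completeness handles all [e < a] at
    once. *)
Lemma common_limit_points (C : lam -> set lam) :
    F [set x | cofinal_in (below x) (C x)] ->
  exists D, [/\ club_in [set: lam] D, F D &
    forall a, D a -> F [set x | a < x /\ limit_points (C x) a]].
Proof.
move=> FC; have [b bP] := least_exists.
have ex e : exists j, F [set x | exists y, [/\ C x y, e < y & y < j]].
  have exg x : exists z, (exists y, [/\ C x y, e < y & y < x]) ->
      [/\ C x z, e < z & z < x].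
    by have [[z ?]|nx] := pselect (exists y, [/\ C x y, e < y & y < x]); [exists z|exists b].
  have [g gP] := choice exg.
  have [e' ee'] := lt_exists e.
  have Fg : F [set x | [/\ C x (g x), e < g x & g x < x]].
    apply: (filter_sub cF) (filter_and cF FC (filter_gt cF e')) => x /= [[Cx xC] e'x].
    apply: gP; have [y Cy e'y] := xC e' e'x.
    by exists y; split=> //; [exact: lt_le_trans e'y|exact: Cx].
  have [|j jP] := nF (g := g); first by apply: (filter_sub cF) Fg => x [].
  exists j; apply: (filter_sub cF) (filter_and cF Fg jP) => x /= [[]] *.
  by exists (g x).
have [j jP] := choice ex.
pose D := [set a | b < a /\ forall e, e < a -> j e <= a].
(* Where closure fails, a witness [e < x] with [x < j e] is regressive in [x]; a bound on [e] then
   bounds these [x]. *)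
have FD : F D.
  have exg x : exists z, (exists e, e < x /\ x < j e) -> z < x /\ x < j z.
    by have [[z ?]|nx] := pselect (exists e, e < x /\ x < j e); [exists z|exists b].
  have [g gP] := choice exg.
  have [|k kP] := @regressive_bounded [set x | exists e, e < x /\ x < j e] g.
    by apply: (filterT cF) => x /= /gP[].
  have [s sP] := small_bounded j (small_below (j := k)).
  apply: (filter_sub cF) (filter_and cF kP (filter_and cF (filter_gt cF b) (filter_gt cF s))).
  move=> x /= [gk [bx sx]]; split=> // e lex; rewrite leNgt; apply/negP => xj.
  have xe : exists e, e < x /\ x < j e by exists e.
  have [_ xjg] := gP x xe.
  by have := lt_trans (lt_trans sx xjg) (sP _ (gk xe)); rewrite ltxx.
exists D; split=> //.
- split; last first.
    split=> // x _; have [y [Dy xy]] := filter_ex cF (filter_and cF FD (filter_gt cF x)).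
    by exists y => //; exact: ltW.
  split=> // a [_ [[y ya] [_ aub]]]; split; first exact: le_lt_trans (bP y) ya.
  move=> e ea; apply: contrapT => /negP; rewrite -ltNge => aj.
  have /aub : ubound (D `&` below a) e.
    move=> z [[_ Dz] za]; rewrite leNgt; apply/negP => ez.
    by have := lt_le_trans aj (Dz e ez); rewrite ltNge (ltW za).
  by rewrite leNgt ea.
- move=> a [ba Da].
  have Fall := filter_all cF (small_below (j := a)) (fun e _ => jP e).
  apply: (filter_sub cF) (filter_and cF Fall (filter_gt cF a)) => x /= [xP ax].
  split=> //; split; first by exists b.
  split=> [y [_ /ltW]//|c cub]; rewrite leNgt; apply/negP => ca.
  have [y [Cy cy yj]] := xP c ca.
  have /cub : (C x `&` below a) y by split=> //; exact: lt_le_trans (Da c ca).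
  by rewrite leNgt cy.
Qed.

(** Otherwise almost every [x] carries a club disjoint from [S]; a point of [S] in the club of
    common limit points lies in such a club by closedness. *)
Lemma stationary_reflects_at_regular (S : set lam) :
  stationary_in [set: lam] S -> reflects_at_regular S.
Proof.
move=> [_ statS]; apply: contrapT => nrefl.
have ex x : exists C, regular_uncountable (below x) ->
    club_in (below x) C /\ ~ (S `&` below x `&` C !=set0).
  have [rx|nr] := pselect (regular_uncountable (below x)); last by exists set0.
  apply: contrapT => nC; apply: nrefl; exists x; split=> //; split; first by move=> y [].
  move=> C clubC; apply: contrapT => nSC; apply: nC; exists C => _; split=> //.
have [C CP] := choice ex.
have [|D [clubD FD DP]] := @common_limit_points C.
  by apply: (filter_sub cF) regular_filter => x /CP[[]].
have [a [Sa Da]] := statS D clubD.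
have [x [/CP[[[_ Ccl] _] nSC] [ax Ca]]] := filter_ex cF (filter_and cF regular_filter (DP a Da)).
by apply: nSC; exists a; split=> //; apply: Ccl; split.
Qed.

(** * Square sequences under a weakly normal filter *)

Lemma regular_cofinal x (C : set lam) : regular_uncountable (below x) ->
    C `<=` below x -> (exists2 s, isLub C s & isLub (below x) s) ->
  cofinal_in (below x) C.
Proof.
move=> rx Cx [s [_ sC] [sx _]]; split=> // y yx.
apply: contrapT => nC.
have [z zx yz] := regular_no_max rx yx.
have : s <= y.
  by apply: sC => w Cw; rewrite leNgt; apply/negP => yw; apply: nC; exists w => //; exact: ltW.
by rewrite leNgt (lt_le_trans yz (sx z zx)).
Qed.

(** Any two distinct members differ at some point below [x]; regularity, applied once for each
    coordinate of the pair, bounds all these points. *)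
Lemma separating_bound x (CC : set (set lam)) : regular_uncountable (below x) ->
    ~ (below x #<= CC) -> (forall C, CC C -> C `<=` below x) ->
  exists2 s, s < x & forall C C', CC C -> CC C' ->
    C `&` below s = C' `&` below s -> C = C'.
Proof.
move=> rx sCC CCx; have [b bP] := least_exists.
have bx : b < x.
  have [_ ux _] := rx; rewrite ltNge; apply/negP => xb; apply: ux.
  suff -> : below x = set0 by exact: countable0.
  by apply/seteqP; split=> // y /= yx; have := lt_le_trans yx xb; rewrite ltNge bP.
have ex (p : set lam * set lam) : exists z, CC p.1 -> CC p.2 ->
    z < x /\ (p.1 <> p.2 -> ~ (p.1 z <-> p.2 z)).
  have [[C1 [C2 neq]]|h] := pselect (CC p.1 /\ CC p.2 /\ p.1 <> p.2); last first.
    by exists b => C1 C2; split=> // neq; case: h.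
  apply: contrapT => nz; apply: neq; apply/seteqP.
  suff H z : p.1 z <-> p.2 z by split=> z /H.
  have [zx|xz] := ltP z x.
    by apply: contrapT => nH; apply: nz; exists z.
  by split=> [/(CCx _ C1)|/(CCx _ C2)]; rewrite /below /= ltNge xz.
have [g gP] := choice ex.
have exs C : exists s, CC C -> s < x /\ forall C', CC C' -> g (C, C') < s.
  have [CCC|nC] := pselect (CC C); last by exists b.
  have [|s sx sP] := @regular_bounded _ lam (below x) _ CC (fun C' => g (C, C')) rx sCC.
    by move=> C' CCC'; have [] := gP (C, C') CCC CCC'.
  by exists s.
have [h hP] := choice exs.
have [|s sx sP] := @regular_bounded _ lam (below x) _ CC h rx sCC.
  by move=> C /hP[].
exists s => // C C' CCC CCC' eqs; apply: contrapT => neq.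
have [_ /(_ neq)] := gP (C, C') CCC CCC'; apply => /=.
have gs : g (C, C') < s.
  by have [_ hC] := hP C CCC; exact: lt_trans (hC C' CCC') (sP C CCC).
split=> Cg.
  by have [] : (C' `&` below s) (g (C, C')) by rewrite -eqs.
by have [] : (C `&` below s) (g (C, C')) by rewrite eqs.
Qed.

Lemma not_square_lt (m : lam) : ~ square_lt lam m.
Proof.
move=> [CC [CCP CCacc nthread]].
have [Cs CsP] : {Cs : lam -> set lam & forall x, CC x (Cs x)}.
  by apply: (@choice _ _ (fun x C => CC x C)) => x; have [] := CCP x.
have CCsub x C : CC x C -> C `<=` below x.
  by move=> CxC; have [_ _ /(_ C CxC)[[]]] := CCP x.
have CCclosed x C a : CC x C -> a < x -> limit_points C a -> C a.
  by move=> CxC ax Ca; have [_ _ /(_ C CxC)[[_ +] _]] := CCP x; apply.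
have [|D [_ FD DP]] := @common_limit_points Cs.
  apply: (filter_sub cF) regular_filter => x /= rx; apply: regular_cofinal => //.
    exact: CCsub.
  by have [_ _ /(_ _ (CsP x))[]] := CCP x.
pose sep s x := forall C C', CC x C -> CC x C' ->
  C `&` below s = C' `&` below s -> C = C'.
have sep_le s t x : s <= t -> sep s x -> sep t x.
  move=> st sepx C C' CxC CxC' eqt; apply: sepx => //.
  have -> : below s = below t `&` below s.
    by apply/seteqP; split=> [z /= zs|z [_]//]; split=> //=; exact: lt_le_trans st.
  by rewrite !setIA eqt.
(* For regular [x > m], [CC x] is smaller than [x], so its members separate at a level below [x].
   This level is regressive in [x], hence one [s] works almost everywhere. *)
have exs x : exists s, regular_uncountable (below x) /\ m < x -> s < x /\ sep s x.
  have [[rx mx]|n] := pselect (regular_uncountable (below x) /\ m < x); last by exists m.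
  have [|s sx sepx] := @separating_bound x (CC x) rx _ (@CCsub x); last by exists s.
  have [_ nm _] := CCP x; move=> xCC; apply: nm; apply: card_le_trans xCC.
  by apply: subset_card_le => z /= zm; exact: lt_trans mx.
have [g gP] := choice exs.
have Frm := filter_and cF regular_filter (filter_gt cF m).
have [|s sP] := nF (g := g).
  by apply: (filter_sub cF) Frm => x /gP[].
have Fsep : F [set x | sep s x].
  apply: (filter_sub cF) (filter_and cF Frm sP) => x /= [/gP[_ sepx] /ltW gs].
  exact: sep_le gs sepx.
have [a0 [Da0 sa0]] := filter_ex cF (filter_and cF FD (filter_gt cF s)).
(* By coherence almost every trace below [a0] lies in the small collection [CC a0], so some trace
   occurs on a positive set. *)
have [X0 pX0] : exists X0, positive F [set x | Cs x `&` below a0 = X0].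
  apply: contrapT => nX0; have [_ nm _] := CCP a0.
  have sCC : small (CC a0).
    by move=> le; apply: nm; apply: card_le_trans le; exact: subset_card_le.
  have FX X : CC a0 X -> F [set x | Cs x `&` below a0 <> X].
    by move=> _; apply: contrapT => nX; apply: nX0; exists X.
  have [x [xP [a0x Ca0]]] := filter_ex cF (filter_and cF (filter_all cF sCC FX) (DP a0 Da0)).
  apply: (xP (Cs x `&` below a0)) => //; apply: CCacc => //; split=> //.
  exact: CCclosed Ca0.
pose Y := [set x | Cs x `&` below a0 = X0].
pose C := [set y | F [set x | Y x -> Cs x y]].
(* For suitable large [c] in [D], almost all [Cs x] with [x] in [Y] have their trace below [c] in
   [CC c]. These traces agree with [X0] below [s < a0], so separation makes them equal, and [C] has
   the same trace. *)
have approx a : exists x c, [/\ a < c, c < x, limit_points (Cs x) c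
    & C `&` below c = Cs x `&` below c].
  have [c [[Dc sepc] [ac a0c]]] := filter_ex cF (filter_and cF (filter_and cF FD Fsep)
    (filter_and cF (filter_gt cF a) (filter_gt cF a0))).
  have [x [Yx [cx Cxc]]] := positive_ex cF pX0 (DP c Dc).
  exists x, c; split=> //.
  have CCc z : c < z /\ limit_points (Cs z) c -> CC c (Cs z `&` below c).
    by move=> [cz Cz]; apply: CCacc => //; split=> //; exact: CCclosed Cz.
  have Csc : F [set z | Y z -> Cs z `&` below c = Cs x `&` below c].
    apply: (filter_sub cF) (DP c Dc) => z /= cz Yz.
    apply: sepc; [exact: CCc|exact: CCc|].
    have -> : below s = below a0 `&` below s.
      by apply/seteqP; split=> [w /= ws|w [_]//]; split=> //=; exact: lt_trans sa0.
    have a0cE : below c `&` below a0 = below a0.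
      by apply/seteqP; split=> [w [_]//|w /= wa]; split=> //=; exact: lt_trans a0c.
    by rewrite !setIA -(setIA (Cs z)) -(setIA (Cs x)) a0cE Yz Yx.
  apply/seteqP; split=> y [Cy yc]; split=> //.
    have [z [Yz [Czy Czc]]] := positive_ex cF pX0 (filter_and cF Cy Csc).
    have : (Cs z `&` below c) y by split=> //; exact: Czy.
    by rewrite Czc// => -[].
  apply: (filter_sub cF) Csc => z /= Czc Yz.
  have : (Cs x `&` below c) y by [].
  by rewrite -Czc// => -[].
have restrict a c x : a < c -> C `&` below c = Cs x `&` below c ->
    C `&` below a = Cs x `&` below a.
  move=> ac CE; have -> : below a = below c `&` below a.
    by apply/seteqP; split=> [w /= wa|w [_]//]; split=> //=; exact: lt_trans ac.
  by rewrite !setIA CE.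
have limE a c x : a < c -> C `&` below c = Cs x `&` below c ->
    limit_points C a -> limit_points (Cs x) a.
  by move=> ac /(restrict _ _ _ ac) CE; rewrite /limit_points /= CE.
apply: nthread; exists C; split.
- split; split=> //.
    move=> a [_ Ca]; have [x [c [ac cx _ CE]]] := approx a.
    have : (Cs x `&` below c) a.
      split=> //; apply: (@CCclosed x) => //; first exact: lt_trans cx.
      exact: (limE a c x).
    by rewrite -CE => -[].
  move=> y _; have [x [c [yc cx [_ [_ club]]] CE]] := approx y.
  apply: contrapT => nC; have /club : ubound (Cs x `&` below c) y.
    rewrite -CE => z [Cz _]; rewrite leNgt; apply/negP => yz.
    by apply: nC; exists z => //; exact: ltW.
  by rewrite leNgt yc.
- move=> a [Ca lima]; have [x [c [ac cx _ CE]]] := approx a.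
  rewrite (restrict _ _ _ ac CE); apply: CCacc => //; split; last exact: (limE a c x).
  have : (C `&` below c) a by [].
  by rewrite CE => -[].
Qed.

End WeaklyNormal.

(** Without such an [h] there is a weakly normal filter, which contradicts either alternative. *)
Lemma positive_partition F : complete_filter F ->
    (exists S : set lam, stationary_in [set: lam] S /\ ~ reflects_at_regular S)
    \/ (exists m : lam, is_cardinal (below m) /\ square_lt lam m) ->
  exists h : lam -> lam, forall t, positive F (h @^-1` [set t]).
Proof.
move=> cF lam_hyp; apply: contrapT => sat.
have [G cG nG] := weakly_normal_exists cF sat.
case: lam_hyp => [[S [statS]]|[m [_]]]; last exact: (not_square_lt cG nG).
by apply; exact: (stationary_reflects_at_regular cG nG).
Qed.

(** * Unbounded sets, tails and the size of lambda times lambda *)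

Lemma unbounded_card (X : set lam) : (forall j, exists2 x, X x & j < x) -> [set: lam] #<= X.
Proof.
move=> uX; have [_ _ + ] := reg; apply; split=> // x _.
by have [y Xy /ltW] := uX x; exists y.
Qed.

Lemma tail_filter : complete_filter [set Z | exists j : lam, forall x, j < x -> Z x].
Proof.
have [b _] := least_exists.
split=> [A B AB [j jA]|G sG GF|j|[j jP]] /=.
- by exists j => x /jA /AB.
- have ex Z : exists j, G Z -> forall x, j < x -> Z x.
    by have [/GF[j]|nG] := pselect (G Z); [exists j|exists b].
  have [j jP] := choice ex.
  have [s sP] := small_bounded j sG.
  by exists s => x sx A GA; apply: (jP A GA); exact: lt_trans (sP A GA) sx.
- by exists j.
- by have [x /jP] := lt_exists j.
Qed.

Hypothesis lam_hyp :
  (exists S : set lam, stationary_in [set: lam] S /\ ~ reflects_at_regular S)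
  \/ (exists m : lam, is_cardinal (below m) /\ square_lt lam m).

(* A partition of lam into lam unbounded sets, for which the filter of tails suffices. *)
Lemma card_square : [set: lam * lam] #<= [set: lam].
Proof.
have [h hP] := positive_partition tail_filter lam_hyp.
have [b _] := least_exists.
have ex t : exists e : lam -> lam, (forall i, h (e i) = t) /\ injective e.
  have [|e [eh einj]] := @card_le_inj _ _ [set: lam] (h @^-1` [set t]) (ex_intro _ b Logic.I).
    apply: unbounded_card => j; apply: contrapT => nj; apply: (hP t).
    by exists j => x jx hx; apply: nj; exists x.
  by exists e; split=> [i|x y]; [exact: eh|exact: einj].
have [e eP] := choice ex.
apply: (@inj_card_leP _ _ _ _ (fun p => e p.1 p.2)) => // -[t i] [u k] _ _ /= ek.
have [ht _] := eP t; have [hu inju] := eP u.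
have tu : t = u by rewrite -(ht i) ek hu.
by rewrite tu; congr pair; apply: inju; rewrite -ek tu.
Qed.

(** * Bounds in the successor cardinal *)

Section Successor.
Context {dK} {K : orderType dK}.
Hypothesis K_wo : well_order (<=%O : rel K).
Hypothesis K_succ : is_successor_cardinal lam K.

Lemma not_onto_succ (f : lam * lam -> K) : ~ forall x, exists p, f p = x.
Proof.
move=> fs; have [nK _] := K_succ; apply: nK.
apply: card_le_trans card_square.
have [g gP] := choice fs.
by apply: (@inj_card_leP _ _ _ _ g) => // x y _ _ gxy; rewrite -(gP x) -(gP y) gxy.
Qed.

Lemma succ_inhabited : exists x : K, True.
Proof.
apply: contrapT => nx; have [nK _] := K_succ; apply: nK.
suff -> : [set: K] = set0 by exact: card_ge0.
by apply/seteqP; split=> // x _; apply: nx; exists x.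
Qed.

Lemma enumerations_below :
  exists e : K -> lam -> K, forall x y, y < x -> exists k, e x k = y.
Proof.
have ex (x : K) : exists e : lam -> K, forall y, y < x -> exists k, e k = y.
  have [[y yx]|n] := pselect (exists y, y < x); last first.
    by exists (fun=> x) => y yx; case: n; exists y.
  have [_ /(_ x) xl] := K_succ.
  have [|e [_ es]] := card_le_surj _ xl; first by exists y.
  by exists e => z /es[k _ ek]; exists k.
by have [e eP] := choice ex; exists e.
Qed.

Lemma succ_le_bounded (g : lam -> K) : exists x, forall i, g i <= x.
Proof.
have [e eP] := enumerations_below.
apply: contrapT => nb; apply: (@not_onto_succ (fun p => e (g p.1) p.2)) => x.
have [i xi] : exists i, x < g i.
  apply: contrapT => ni; apply: nb; exists x => i.
  by rewrite leNgt; apply/negP => xi; apply: ni; exists i.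
by have [k ek] := eP _ _ xi; exists (i, k).
Qed.

Lemma succ_lt_exists (x : K) : exists y, x < y.
Proof.
have [e eP] := enumerations_below.
have [b _] := least_exists; have [b' bb'] := lt_exists b.
apply: contrapT => nx.
(* First coordinate [b] selects the enumeration of the points below [x]; any other selects [x], the
   supposed maximum. *)
apply: (@not_onto_succ (fun p => if p.1 == b then e x p.2 else x)) => y.
case: (ltgtP y x) => [/eP[k ek]|xy|->].
- by exists (b, k); rewrite eqxx.
- by case: nx; exists y.
- by exists (b', b); rewrite gt_eqF.
Qed.

Lemma succ_bounded (g : lam -> K) : exists x, forall i, g i < x.
Proof.
have [x xP] := succ_le_bounded g; have [y xy] := succ_lt_exists x.
by exists y => i; exact: le_lt_trans xy.
Qed.

Lemma card_le_succ_bounded (a : set K) : a #<= [set: lam] -> exists x, forall y, a y -> y < x.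
Proof.
move=> al; have [[y ay]|na] := pselect (a !=set0); last first.
  by have [x _] := succ_inhabited; exists x => y ay; case: na; exists y.
have [|g [_ gs]] := card_le_surj _ al; first by exists y.
by have [x xP] := succ_bounded g; exists x => z /gs[i _ <-].
Qed.

Lemma order_type_card_le (s : lam) (a : set K) : has_order_type a s -> a #<= below s.
Proof.
move=> [f [[fs finj _] _]]; apply: (@inj_card_leP _ _ _ _ f) => // x y ax ay.
by apply: finj; rewrite inE.
Qed.

Lemma small_order_type (a : set K) : small a -> exists s : lam, has_order_type a s.
Proof.
move=> sa; have [||s _ sP] := @order_type_exists _ K _ lam K_wo wo [set: lam] a; last by exists s.
- by [].
- exact: sa.
Qed.

Lemma small_succ_bounded (a : set K) : small a -> exists x, forall y, a y -> y < x.
Proof.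
move=> /small_order_type[s /order_type_card_le as_]; apply: card_le_succ_bounded.
exact: card_le_trans as_ (card_leT _).
Qed.

Lemma unbounded_succ_card (U : set K) : (forall x, exists2 y, U y & x <= y) -> [set: K] #<= U.
Proof.
move=> uU; apply: contrapT => KU.
have [||s _ [f [[fs finj _] _]]] := @order_type_exists _ K _ K K_wo K_wo [set: K] U.
- by [].
- exact: KU.
have [|x xP] := @card_le_succ_bounded U.
  have [_ /(_ s)] := K_succ; apply: card_le_trans.
  apply: (@inj_card_leP _ _ _ _ f) => // x y Ux Uy.
  by apply: finj; rewrite inE.
by have [y Uy xy] := uU x; have := xP y Uy; rewrite ltNge xy.
Qed.

(* Large families without reference to order types and disjointness, so that
   they are closed under combination and splitting. *)
Definition unbounded_family (A : set (set K)) :=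
  forall x, exists a, [/\ A a, a !=set0, small a & forall y, a y -> x < y].

(** * Unbounded families and their relation to large disjoint ones *)

Lemma unbounded_family_split (A : set (set K)) (x0 : K) (P : lam -> set K -> Prop) :
    unbounded_family A ->
    (forall a, A a -> small a -> (forall y, a y -> x0 < y) -> exists i, P i a) ->
  exists i, unbounded_family [set a | A a /\ P i a].
Proof.
move=> uA AP; apply: contrapT => nu.
have ex i : exists x, ~ exists a, [/\ A a /\ P i a, a !=set0, small a & forall y, a y -> x < y].
  by apply: contrapT => nx; apply: nu; exists i => x; apply: contrapT => na; apply: nx; exists x.
have [g gP] := choice ex.
have [x xP] := succ_bounded g.
have [a [Aa a0 sa xa]] := uA (Order.max x x0).
have [|i Pia] := AP a Aa sa; first by move=> y /xa; rewrite gt_max => /andP[].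
apply: (gP i); exists a; split=> // y /xa; rewrite gt_max => /andP[xy _].
exact: lt_trans xy.
Qed.

(** By disjointness each point up to [x] determines at most one member containing it, so at most
    lambda members have a point there. *)
Lemma unbounded_family_of_large (s : lam) (A : set (set K)) :
  large_disjoint_family s A -> unbounded_family A.
Proof.
move=> [Atype Atriv /card_eqPle[_ KA]] x; apply: contrapT => nx.
have [e eP] := enumerations_below.
have [b _] := least_exists; have [b' bb'] := lt_exists b.
have [x' xx'] := succ_lt_exists x.
have [|g [_ gs]] := card_le_surj _ KA; first by have [y _] := succ_inhabited; exists y.
have ex k : exists a : set K, forall a', A a' -> a' (e x' k) -> a' = a.
  have [[a [Aa ae]]|n] := pselect (exists a, A a /\ a (e x' k)); last first.
    by exists set0 => a' Aa' a'e; case: n; exists a'.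
  by exists a => a' Aa' a'e; apply: Atriv => //; exists (e x' k).
have [r rP] := choice ex.
(* A first coordinate other than [b] accounts for the possible empty member, which no point
   determines. *)
apply: (@not_onto_succ (fun p => g (if p.1 == b then r p.2 else set0))) => y.
have [a Aa <-] := gs y Logic.I.
have [[z az]|a0] := pselect (a !=set0); last first.
  exists (b', b); rewrite gt_eqF//=; congr g.
  by apply/seteqP; split=> // w aw; case: a0; exists w.
have [w aw wx] : exists2 w, a w & w <= x.
  apply: contrapT => nw; apply: nx; exists a; split=> //.
  - by exists z.
  - by apply: small_le (order_type_card_le (Atype a Aa)) _; exact: small_below.
  - by move=> w aw; rewrite ltNge; apply/negP => wx; apply: nw; exists w.
have [k ek] := eP x' w (le_lt_trans wx xx').
by exists (b, k); rewrite eqxx /= -(rP k a)// ek.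
Qed.

(** Choose members recursively, each above all previous ones. There are only lambda possible order
    types, so one of them recurs unboundedly. *)
Lemma large_of_unbounded_family (A : set (set K)) : unbounded_family A ->
  exists s : lam, exists2 B, B `<=` A & large_disjoint_family s B.
Proof.
move=> uA; have [e eP] := enumerations_below.
pose P (x : K) (f : K -> set K) (a : set K) := [/\ A a, a !=set0, small a
  & forall y, y < x -> forall u v, f y u -> a v -> u < v].
have [x f g a fg [Aa a0 sa aP]|x f IH|f fP] := wo_rec K_wo set0 (P := P).
- by split=> // y yx; rewrite -fg//; exact: aP.
- have exb y : exists u, y < x -> forall v, f y v -> v < u.
    have [yx|_] := ltP y x; last by exists x.
    have [_ _ sf _] := IH y yx.
    by have [u uP] := small_succ_bounded sf; exists u.
  have [u uP] := choice exb.
  have [z zP] := succ_bounded (fun k => u (e x k)).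
  have [a [Aa a0 sa za]] := uA z; exists a; split=> // y yx v w fv aw.
  have [k ek] := eP x y yx.
  apply: lt_trans (uP y yx v fv) _; rewrite -ek.
  exact: lt_trans (zP k) (za w aw).
have fdisj x y : f x `&` f y !=set0 -> x = y.
  move=> [z [xz yz]]; have [_ _ _ lx] := fP x; have [_ _ _ ly] := fP y.
  case: (ltgtP x y) => // [xy|yx].
    by have := ly x xy z z xz yz; rewrite ltxx.
  by have := lx y yx z z yz xz; rewrite ltxx.
have exs x : exists s : lam, has_order_type (f x) s.
  by have [_ _ /small_order_type] := fP x.
have [s us] : exists s : lam, forall x, exists2 y, has_order_type (f y) s & x <= y.
  apply: contrapT => ns.
  have exx (s : lam) : exists x, ~ exists2 y, has_order_type (f y) s & x <= y.
    by apply: contrapT => nx; apply: ns; exists s => x; apply: contrapT => ny; apply: nx; exists x.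
  have [g gP] := choice exx; have [x xP] := succ_bounded g; have [s sP] := exs x.
  by apply: (gP s); exists x => //; exact: ltW.
exists s, (f @` [set y | has_order_type (f y) s]).
  by move=> _ [y _ <-]; have [] := fP y.
split.
- by move=> _ [y ? <-].
- by move=> _ _ [x _ <-] [y _ <-] /fdisj ->.
apply/card_eqPle; split.
  exact: card_le_trans (card_image_le _ _) (card_leT _).
apply: card_le_trans (unbounded_succ_card us) _.
apply: (@inj_card_leP _ _ _ _ f) => [y sy|x y _ _ fxy]; first by exists y.
by apply: fdisj; rewrite fxy setIid; have [] := fP y.
Qed.

(** * Attained colors and their filter *)

Lemma image2_set1P (X Y Z : Type) (c : X -> Y -> Z) (a : set X) (b : set Y) (t : Z) :
  [set c x y | x in a & y in b] = [set t] <->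
  [/\ a !=set0, b !=set0 & forall x y, a x -> b y -> c x y = t].
Proof.
split=> [E|[[x ax] [y yb] ct]].
  have [x ax [y yb _]] : [set c x y | x in a & y in b] t by rewrite E.
  split; [by exists x|by exists y|move=> u v au bv].
  by have : [set c x y | x in a & y in b] (c u v) by [exists u => //; exists v]; rewrite E.
apply/seteqP; split=> [_ [u au [v bv <-]]|_ ->]; first exact: ct.
by exists x => //; exists y => //; exact: ct.
Qed.

Definition attained (Z : Type) (c : K -> K -> Z) (A : set (set K)) (t : Z) :=
  exists a b, [/\ A a, A b, set_lt a b & [set c x y | x in a & y in b] = [set t]].

Lemma Pr1_attained (Z : Type) : Pr1 K lam Z <->
  exists c : K -> K -> Z, forall A, unbounded_family A -> forall t, attained c A t.
Proof.
split=> [] [c cP]; exists c.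
  move=> A /large_of_unbounded_family[s [B BA /cP cB]] t.
  by have [a [b [/BA Aa /BA Ab ab ct]]] := cB t; exists a, b.
by move=> s A /unbounded_family_of_large /cP.
Qed.

Lemma U1_attained : U1 K lam lam <->
  exists c : K -> K -> lam, forall A, unbounded_family A ->
    forall e, exists2 t, e < t & attained c A t.
Proof.
split=> [] [c cP]; exists c.
  move=> A /large_of_unbounded_family[s [B BA /cP cB]] e.
  have [a [b [t [/BA Aa /BA Ab ab et ct]]]] := cB e.
  by exists t => //; exists a, b.
move=> s A /unbounded_family_of_large /cP cA e.
by have [t et [a [b [Aa Ab ab ct]]]] := cA e; exists a, b, t.
Qed.

(** For completeness, take unions of one member from each of the given families: a monochromatic
    rectangle of unions contains one of the same color for every family. *)
Lemma attained_filter (c : K -> K -> lam) :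
    (forall A, unbounded_family A -> forall e, exists2 t, e < t & attained c A t) ->
  complete_filter [set Z | exists A j, unbounded_family A /\
    forall t, j < t -> attained c A t -> Z t].
Proof.
move=> cP; have [b _] := least_exists.
have u1 : unbounded_family (range set1).
  move=> x; have [y xy] := succ_lt_exists x; exists [set y]; split.
  - by exists y.
  - by exists y.
  - exact: small_countable (countable1 y).
  - by move=> _ ->.
split=> [Z Z' ZZ' [A [j [uA AZ]]]|G sG GF|j|[A [j [uA nA]]]] /=.
- by exists A, j; split=> // t jt /(AZ t jt) /ZZ'.
- have [[Z0 GZ0]|G0] := pselect (G !=set0); last first.
    by exists (range set1), b; split=> // t _ _ Z GZ; case: G0; exists Z.
  have ex Z : exists p : set (set K) * lam, G Z -> unbounded_family p.1 /\
      forall t, p.2 < t -> attained c p.1 t -> Z t.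
    have [/GF[A [j Aj]]|n] := pselect (G Z); first by exists (A, j).
    by exists (set0, b).
  have [p pP] := choice ex.
  have [s sP] := small_bounded (fun Z => (p Z).2) sG.
  exists [set a | exists f : set lam -> set K,
    (forall Z, G Z -> (p Z).1 (f Z) /\ f Z !=set0) /\ a = \bigcup_(Z in G) f Z], s.
  split.
    move=> x.
    have exf Z : exists a, G Z -> [/\ (p Z).1 a, a !=set0, small a & forall y, a y -> x < y].
      have [/pP[uA _]|n] := pselect (G Z); last by exists set0.
      by have [a aP] := uA x; exists a.
    have [f fP] := choice exf.
    exists (\bigcup_(Z in G) f Z); split.
    + by exists f; split=> // Z /fP[].
    + by have [_ [y fy] _ _] := fP Z0 GZ0; exists y, Z0.
    + by apply: small_bigcup => // Z /fP[].
    + by move=> y [Z /fP[_ _ _ fx] /fx].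
  move=> t st [_ [_ [[f [fP ->]] [g [gP ->]] fg /image2_set1P[_ _ ct]]]] Z GZ.
  have [_ pZ] := pP Z GZ; have [pf f0] := fP Z GZ; have [pg g0] := gP Z GZ.
  apply: pZ; first exact: lt_trans (sP Z GZ) st.
  exists (f Z), (g Z); split=> //.
    by move=> x y fx gy; apply: fg; exists Z.
  by apply/image2_set1P; split=> // x y fx gy; apply: ct; exists Z.
- by exists (range set1), j; split.
- by have [t jt /(nA t jt)] := cP A uA j.
Qed.

(** * Raising the number of colors to the successor *)

(** At stage [x] and argument [i], only the functions of index [e x k] with [k < i] are avoided;
    these are fewer than lambda, and the fibre of [h] over [i] is unbounded. *)
Lemma eventually_different (h : lam -> lam) :
    (forall i j, exists2 k, h k = i & j < k) ->
  exists p : K -> lam -> lam, (forall x i, h (p x i) = i) /\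
    forall x y, x <> y -> exists j, forall i, j < i -> p x i <> p y i.
Proof.
move=> hP; have [e eP] := enumerations_below.
pose P (x : K) (p : K -> lam -> lam) (q : lam -> lam) := (forall i, h (q i) = i) /\
  forall i k, k < i -> e x k < x -> p (e x k) i <> q i.
have [x f g q fg [hq qP]|x f _|p pP] := wo_rec K_wo id (P := P).
- by split=> // i k ki ex; rewrite -fg//; exact: qP.
- have exq i : exists q, h q = i /\ forall k, k < i -> f (e x k) i < q.
    have [s sP] := small_bounded (fun k => f (e x k) i) (small_below (j := i)).
    have [q hq sq] := hP i s; exists q; split=> // k ki.
    exact: lt_trans (sP k ki) sq.
  have [q qP] := choice exq; exists q; split=> [i|i k ki _ E].
    by have [] := qP i.
  by have [_ /(_ k ki)] := qP i; rewrite E ltxx.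
have diff x y : y < x -> exists j, forall i, j < i -> p x i <> p y i.
  move=> yx; have [k ek] := eP x y yx; exists k => i ki E.
  by have [_ /(_ i k ki)] := pP x; rewrite ek => /(_ yx); apply.
exists p; split=> [x i|x y xy]; first by have [] := pP x.
case: (ltgtP x y) => // [/diff|/diff]; last by [].
by move=> [j jP]; exists j => i ji /esym; exact: jP.
Qed.

Lemma more_colors (h : lam -> lam) (c : K -> K -> lam) :
    (forall i j, exists2 k, h k = i & j < k) ->
    (forall A, unbounded_family A -> forall t, attained c A t) ->
  exists d : K -> K -> K, forall A, unbounded_family A -> forall t, attained d A t.
Proof.
move=> hP cP; have [e eP] := enumerations_below.
have [p [hp pdiff]] := eventually_different hP.
pose first y s k := p (e y k) (h s) = s /\ forall l, l < k -> p (e y l) (h s) <> s.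
have exv (q : K * lam) : exists v, forall k, first q.1 q.2 k -> v = e q.1 k.
  have [[k [kq kmin]]|n] := pselect (exists k, first q.1 q.2 k); last first.
    by exists q.1 => k kq; case: n; exists k.
  exists (e q.1 k) => l [lq lmin]; congr (e q.1).
  by case: (ltgtP k l) => // [/lmin|/kmin]; [move=> /(_ kq)|move=> /(_ lq)].
have [v vP] := choice exv.
exists (fun x y => v (y, c x y)) => A uA t.
(* This makes the search along [e y] for the color [p t i] return [t]. *)
pose ok i y := exists2 k, e y k = t & forall l, l < k -> p (e y l) i = p t i -> e y l = t.
have okv i y : ok i y -> v (y, p t i) = t.
  move=> [k ek kP].
  have [l lE lmin] := wo_min wo (A := [set l | p (e y l) i = p t i])
    (ex_intro _ k (congr1 (p ^~ i) ek)).
  have lfirst : first y (p t i) l.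
    split; rewrite hp// => m ml /lmin; rewrite leNgt ml//.
  rewrite (vP (y, p t i) l lfirst) /=.
  have /= := lmin k; rewrite ek => /(_ erefl); rewrite le_eqVlt => /orP[/eqP ->//|lk].
  exact: kP.
have ev y : t < y -> exists j, forall i, j < i -> ok i y.
  move=> ty; have [k ek] := eP y t ty.
  have exj l : exists j, e y l <> t -> forall i, j < i -> p (e y l) i <> p t i.
    have [->|/pdiff[j jP]] := pselect (e y l = t); first by exists k.
    by exists j.
  have [j jP] := choice exj.
  have [s sP] := small_bounded j (small_below (j := k)).
  exists s => i si; exists k => // l lk E; apply: contrapT => lt.
  by apply: (jP l lt i _ E); exact: lt_trans (sP l lk) si.
(* As members are small, one [i] serves a whole member, and some [i] serves an unbounded subfamily;
   there [c] is asked for the color [p t i]. *)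
have [|i ui] := @unbounded_family_split A t (fun i a => forall y, a y -> ok i y) uA.
  move=> a Aa sa ta.
  have exj y : exists j, a y -> forall i, j < i -> ok i y.
    have [/ta/ev[j jP]|n] := pselect (a y); first by exists j.
    by have [j _] := least_exists; exists j.
  have [j jP] := choice exj.
  have [s sP] := small_bounded j sa.
  by exists s => y ay; apply: (jP y ay); exact: sP.
have [a [b [[Aa _] [Ab okb] ab /image2_set1P[a0 b0 ct]]]] := cP _ ui (p t i).
exists a, b; split=> //; apply/image2_set1P; split=> // x y ax yb.
by rewrite ct//; apply: okv; exact: okb.
Qed.

(** * The implications between U_1 and Pr_1 *)

Lemma U1_Pr1 : U1 K lam lam -> Pr1 K lam K.
Proof.
move=> /U1_attained[c cP].
have cF := attained_filter cP.
have [h hP] := positive_partition cF lam_hyp.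
have hunb i j : exists2 k, h k = i & j < k.
  by have [k [hk jk]] := positive_ex cF (hP i) (filter_gt cF j); exists k.
apply/Pr1_attained; apply: (@more_colors h (fun x y => h (c x y))) => // A uA t.
have [b0 _] := least_exists.
(* The positive fibre of [h] over [t] meets the set of colors attained on [A], which is in the
   filter. *)
have [|u [/= <- [a [b [Aa Ab ab /image2_set1P[a0 bn0 ct]]]]]] :=
    @positive_ex _ cF (h @^-1` [set t]) (attained c A) (hP t).
  by exists A, b0; split.
exists a, b; split=> //; apply/image2_set1P; split=> // x y ax yb.
by rewrite ct.
Qed.

Lemma Pr1_succ_Pr1 : Pr1 K lam K -> Pr1 K lam lam.
Proof.
move=> [c cP].
have lK : [set: lam] #<= [set: K].
  apply: contrapT => /small_order_type[s /order_type_card_le Ks].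
  by have [+ _] := K_succ; apply; exact: card_le_trans Ks (card_leT _).
have [b _] := least_exists.
have [|g [_ gs]] := card_le_surj _ lK; first by exists b.
exists (fun x y => g (c x y)) => s A /cP cA t.
have [u _ gu] := gs t Logic.I.
have [a [a' [Aa Aa' aa' /image2_set1P[a0 a'0 cu]]]] := cA u.
exists a, a'; split=> //; apply/image2_set1P; split=> // x y ax ya'.
by rewrite cu.
Qed.

Lemma Pr1_U1 : Pr1 K lam lam -> U1 K lam lam.
Proof.
move=> [c cP]; exists c => s A /cP cA e.
have [t et] := lt_exists e; have [a [b [Aa Ab ab ct]]] := cA t.
by exists a, b, t.
Qed.

End Successor.
End Small.

(* lam and kap represent the cardinals lambda and lambda^+. *)
Theorem corollary4p3
  (dl dk : Order.disp_t) (lam : orderType dl) (kap : orderType dk)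
  (lam_wo : well_order (<=%O : rel lam))
  (kap_wo : well_order (<=%O : rel kap))
  (lam_reg : regular_uncountable [set: lam]%classic)
  (kap_succ : is_successor_cardinal lam kap)
  (lam_hyp :
    (exists S : set lam,
       stationary_in [set: lam]%classic S /\ ~ reflects_at_regular S)
    \/ (exists m : lam, is_cardinal (below m) /\ square_lt lam m)) :
  (Pr1 kap lam kap <-> Pr1 kap lam lam)
  /\ (Pr1 kap lam lam <-> U1 kap lam lam).
Proof.
have U1_Pr1_kap := U1_Pr1 lam_wo lam_reg lam_hyp kap_wo kap_succ.
have Pr1_kap_lam := Pr1_succ_Pr1 lam_wo lam_reg kap_wo kap_succ.
have Pr1_lam_U1 := @Pr1_U1 _ _ lam_reg _ kap.
split; split; by auto.
Qed.
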